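(* There is $\varepsilon_0>0$ such that the following holds for every $0\le\varepsilon\le\varepsilon_0$ and every $R>0$. Suppose that a compact set $E\subset\mathbb H^1$ is $\varepsilon$-Reifenberg flat with respect to $Oz$ in $\bar B_\infty(0,R)$. Then, topologically, $E\cap B_\infty(0,R)$ is locally the image of a simple curve: every point of $E\cap B_\infty(0,R)$ has a neighbourhood $V$ in $\mathbb H^1$ such that $E\cap V$ is the image of a simple (injective, continuous) curve.
   Context: The Heisenberg group $\mathbb H^1$ is $\mathbb R^3$ with the law $(x,y,z)(x',y',z')=(x+x',y+y',z+z'+2x'y-2xy')$, and $\pi(x,y,z)=(x,y)$, $Oz=\{x=y=0\}$. Put $\rho_\infty(x,y,z)=\max\{\sqrt{x^2+y^2},|z|^{1/2}\}$ and $d_\infty(A,B)=\rho_\infty(B^{-1}A)$ (a left-invariant metric); $B_\infty(A,r)$ and $\bar B_\infty(A,r)$ are the open and closed balls. For $E\subset\mathbb H^1$: $E_{A,r}=E\cap\bar B_\infty(A,r)$; $Z_A=\{B:\pi(B)=\pi(A)\}$, $Z_{A,r}=Z_A\cap\bar B_\infty(A,r)$; $\operatorname{dist}_H$ is the Hausdorff distance between sets with respect to $d_\infty$. A closed set $E$ is $\varepsilon$-Reifenberg flat with respect to the vertical subgroup $Oz$ in $U\subset\mathbb H^1$ (from scale $r_0>0$ on) if $\operatorname{dist}_H(E_{A,r},Z_{A,r})\le r\varepsilon$ for all $A\in E\cap U$ and all $0<r\le r_0$; here this is assumed for some $r_0>0$. *)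

(* Defs.v *)
From HB Require Import structures.
From mathcomp Require Import all_boot all_order all_algebra.
From mathcomp Require Import all_classical all_reals all_analysis.

Set Implicit Arguments.
Unset Strict Implicit.
Unset Printing Implicit Defensive.

Import Order.TTheory GRing.Theory Num.Theory.
Import numFieldNormedType.Exports.

Local Open Scope classical_set_scope.
Local Open Scope ring_scope.

(* The point (x, y, z) is the nested pair ((x, y), z). The topology is the    *)
(* product topology of R^3, which is also the topology induced by hdist.      *)
Definition heis (R : realType) : Type := (R * R * R)%type.

HB.instance Definition _ (R : realType) :=
  Topological.copy (heis R) (R * R * R)%type.

Section Heisenberg.
Context {R : realType}.
Implicit Types (A B : heis R) (S T E U : set (heis R)) (r e : R).

Definition horigin : heis R := (0, 0, 0).

Definition hmul A B : heis R :=
  (A.1.1 + B.1.1, A.1.2 + B.1.2,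
   A.2 + B.2 + 2 * B.1.1 * A.1.2 - 2 * A.1.1 * B.1.2).

Definition hinv A : heis R := (- A.1.1, - A.1.2, - A.2).

Definition hproj A : R * R := A.1.

Definition hnorm A : R :=
  Num.max (Num.sqrt (A.1.1 ^+ 2 + A.1.2 ^+ 2)) (Num.sqrt `|A.2|).

Definition hdist A B : R := hnorm (hmul (hinv B) A).

Definition hball A r : set (heis R) := [set B | hdist A B < r].

Definition hcball A r : set (heis R) := [set B | hdist A B <= r].

(* The left coset A * Oz of the vertical subgroup Oz.                         *)
Definition vline A : set (heis R) := [set B | hproj B = hproj A].

Definition hdist_set A S : \bar R := ereal_inf [set (hdist A B)%:E | B in S].

(* This is the usual Hausdorff distance when S and T are nonempty; note that  *)
(* ereal_sup set0 = -oo.                                                      *)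
Definition hausdorff_dist S T : \bar R :=
  maxe (ereal_sup [set hdist_set A T | A in S])
       (ereal_sup [set hdist_set B S | B in T]).

Definition reifenberg_flat_vertical E e U r0 : Prop :=
  closed E /\
  forall A r, E A -> U A -> 0 < r -> r <= r0 ->
    (hausdorff_dist (E `&` hcball A r) (vline A `&` hcball A r)
       <= (r * e)%:E)%E.

Definition simple_curve (gamma : R -> heis R) : Prop :=
  {within `[0, 1], continuous gamma} /\ {in `[0, 1] &, injective gamma}.

End Heisenberg.

(* Main.v *)
Require Import Defs.
From mathcomp Require Import all_boot all_order all_algebra.
From mathcomp Require Import all_classical all_reals all_analysis.
From mathcomp Require Import ring lra.
Import Order.TTheory GRing.Theory Num.Theory.
Import numFieldNormedType.Exports.
Local Open Scope classical_set_scope.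
Local Open Scope ring_scope.

(* For points A, B of the group, let gap(A, B) be the squared distance of     *)
(* their projections and let rise(A, B) be the vertical coordinate of         *)
(* A^-1 B, so that d(A, B)^2 = max(gap, |rise|). Flatness at scale d(A, B)    *)
(* forces gap <= k |rise| on E locally, with k small. The rise is not         *)
(* additive, but the defect of rise(A, C) - rise(A, B) - rise(B, C) is at     *)
(* most gap(A, B) + gap(B, C); hence "rise(A, B) > 0" is a total order on E   *)
(* near a point, compatible with the topology. It is dense, because flatness  *)
(* provides a point of E near half the rise between two points. A compact     *)
(* set with such an order is an arc: the map                                  *)
(* x |-> sum_n 2^-(n+1) sup_(y <= x) bump_n(y), for a countable family of     *)
(* bumps separating the points, is continuous and strictly increasing, and    *)
(* its image has no gap because the order is dense.                           *)

(** Flatness enters only through [flat_gap], which makes E nearly vertical at each of its points in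
    the ball, and [flat_point], which finds points of E near any prescribed small rise. Around a
    point A of E they yield points P and Q of E slightly below and slightly above A. The
    neighbourhood V of [local_arc] consists of the points of a small ball around A lying between P
    and Q. It is a neighbourhood because P < A < Q strictly, and it is closed, so E meets it in a
    compact set; moreover a point of E inserted halfway between two points of this set stays in it,
    which makes the order dense.

    The rest is topology, done in [quasi_additive_arc] for a compact set K ordered by the sign of a
    function w that is additive up to a factor. There [height] is continuous, strictly increasing,
    and onto an interval, so its inverse is the required curve. *)

(** * Compact sets with a quasi-additive order *)

Definition halves_sum {R : realType} (u : nat -> R) : R :=
  limn (series (fun n => 2^-1 ^+ n.+1 * u n)).

Lemma cvg_halves {R : realType} (e : R) :
  series (fun n => 2^-1 ^+ n.+1 * e) @ \oo --> e.
Proof.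
have -> : (fun n => 2^-1 ^+ n.+1 * e) = geometric (e / 2) 2^-1.
  by apply/funext => n /=; rewrite exprS; ring.
have {2}-> : e = e / 2 * (1 - 2^-1)^-1 by field.
by apply: cvg_geometric_series; rewrite ger0_norm; lra.
Qed.

Lemma is_cvg_halves {R : realType} {u : nat -> R} :
  (forall n, 0 <= u n <= 1) -> cvgn (series (fun n => 2^-1 ^+ n.+1 * u n)).
Proof.
move=> u01; have c0 n : 0 <= 2^-1 ^+ n.+1 :> R by rewrite exprn_ge0.
apply: series_le_cvg (cvgP _ (cvg_halves 1)) => [n|n|n].
- by rewrite mulr_ge0//; case/andP: (u01 n).
- by rewrite mulr1.
- by rewrite ler_wpM2l//; case/andP: (u01 n).
Qed.

(** The weights 2^-(n+1) sum to 1, so a uniform error e in the terms costs exactly e in the sum. *)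
Lemma halves_sum_leD {R : realType} (u v : nat -> R) (e : R) :
  (forall n, 0 <= u n <= 1) -> (forall n, 0 <= v n <= 1) ->
  (forall n, u n <= v n + e) -> halves_sum u <= halves_sum v + e.
Proof.
move=> u01 v01 uve; rewrite /halves_sum.
rewrite -[X in _ <= _ + X](cvg_lim (@Rhausdorff R) (cvg_halves e)).
rewrite -lim_seriesD; [|exact: is_cvg_halves|exact: cvgP (cvg_halves e)].
apply: lim_series_le; first exact: is_cvg_halves.
  apply: is_cvg_seriesD; [exact: is_cvg_halves|exact: cvgP (cvg_halves e)].
by move=> n; rewrite !fctE -mulrDr ler_wpM2l// exprn_ge0.
Qed.

Lemma halves_sum_lt {R : realType} (u v : nat -> R) (k : nat) :
  (forall n, 0 <= u n <= 1) -> (forall n, 0 <= v n <= 1) ->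
  (forall n, u n <= v n) -> u k < v k -> halves_sum u < halves_sum v.
Proof.
move=> u01 v01 uv uvk; rewrite -subr_gt0 /halves_sum.
have cu := is_cvg_halves u01; have cv := is_cvg_halves v01.
rewrite -lim_seriesB//; set f := (X in series X).
have f0 n : 0 <= f n.
  rewrite /f !fctE -mulrBr mulr_ge0 ?subr_ge0// exprn_ge0//.
have fk0 : 0 < f k by rewrite /f !fctE -mulrBr mulr_gt0 ?subr_gt0// exprn_gt0.
apply: lt_le_trans fk0 _; apply: (@le_trans _ _ (series f k.+1)).
  by rewrite seriesSr lerDr /series /=; apply: sumr_ge0.
apply: nondecreasing_cvgn_le; last exact: is_cvg_seriesB.
by apply/nondecreasing_seqP => n; rewrite seriesSr lerDl.
Qed.

(* The relation 0 < w x y is the order on K. *)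
Record quasi_additive {R : realType} {V : normedModType R} (K : set V)
    (w : V -> V -> R) : Prop := {
  qa_anti : forall x y, w y x = - w x y;
  qa_eq : forall x y, K x -> K y -> w x y = 0 -> x = y;
  qa_add : forall x y z, K x -> K y -> K z ->
    0 <= w x y -> 0 <= w y z -> w x y + w y z <= 2 * w x z;
  qa_near : forall x (e : R), K x -> 0 < e ->
    exists2 s : R, 0 < s & forall y, K y -> `|w x y| < s -> `|x - y| < e;
  qa_cont : forall x (s : R), K x -> 0 < s ->
    exists2 e : R, 0 < e & forall y, K y -> `|x - y| < e -> `|w x y| < s }.

Arguments qa_anti {R V K w}.
Arguments qa_eq {R V K w}.
Arguments qa_add {R V K w}.
Arguments qa_near {R V K w}.
Arguments qa_cont {R V K w}.

Section Arc.
Context {R : realType} {V : normedModType R}.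
Variables (K : set V) (w : V -> V -> R) (q : nat -> V).
Hypothesis Kw : quasi_additive K w.
Hypothesis q_dense : forall x (e : R), K x -> 0 < e -> exists n, `|x - q n| < e.

(* The index n codes the center (a term of q) and the radius of the bump. *)
Definition bump (n : nat) (y : V) : R :=
  let p := odflt (0, 0)%N (unpickle n) in
  Num.max 0 (p.2.+1%:R^-1 - `|y - q p.1|).

Lemma bump_ge0 n y : 0 <= bump n y.
Proof. by rewrite /bump le_max lexx. Qed.

Lemma bump_le1 n y : bump n y <= 1.
Proof.
rewrite /bump; set p := odflt _ _; rewrite ge_max ler01/= lerBlDr.
apply: (@le_trans _ _ 1); last by rewrite lerDl.
by rewrite invf_le1// ler1n.
Qed.

Lemma bump_lip n x y : bump n y <= bump n x + `|x - y|.
Proof.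
rewrite /bump; set p := odflt _ _; rewrite ge_max; apply/andP; split.
  by rewrite addr_ge0// le_max lexx.
rewrite addr_maxl le_max; apply/orP; right.
have : `|x - q p.1| <= `|x - y| + `|y - q p.1| by exact: ler_distD.
by move: (p.2.+1%:R^-1) => a; lra.
Qed.

(** A supremum over the initial segment below x is monotone along the order by construction. For x
    in K the segment contains x and the bumps are at most 1, so the supremum is a genuine one. *)
Definition running (n : nat) (x : V) : R :=
  sup [set bump n y | y in [set y | K y /\ 0 <= w y x]].

Lemma w_refl x : w x x = 0.
Proof. by have := qa_anti Kw x x; lra. Qed.

Lemma running_ub n x y : K y -> 0 <= w y x -> bump n y <= running n x.
Proof.
move=> Ky yx; apply: ub_le_sup; last by exists y.
by exists 1 => _ [z _ <-]; exact: bump_le1.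
Qed.

Lemma running_le n x c : K x ->
  (forall y, K y -> 0 <= w y x -> bump n y <= c) -> running n x <= c.
Proof.
move=> Kx H; apply: ge_sup.
  by exists (bump n x), x => //; split => //; rewrite w_refl.
by move=> _ [y [Ky yx] <-]; exact: H.
Qed.

Lemma running01 x : K x -> forall n, 0 <= running n x <= 1.
Proof.
move=> Kx n; apply/andP; split.
  by apply: le_trans (running_ub n x x Kx _); [exact: bump_ge0|rewrite w_refl].
by apply: running_le => // y _ _; exact: bump_le1.
Qed.

Lemma w_trans {x y z} : K x -> K y -> K z -> 0 <= w x y -> 0 <= w y z ->
  0 <= w x z.
Proof. by move=> Kx Ky Kz xy yz; have := qa_add Kw _ _ _ Kx Ky Kz xy yz; lra. Qed.

Lemma running_mono n x y : K x -> K y -> 0 <= w x y ->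
  running n x <= running n y.
Proof.
move=> Kx Ky xy; apply: running_le => // z Kz zx; apply: running_ub => //.
exact: w_trans Kz Kx Ky zx xy.
Qed.

(** Only points between x and y can raise the supremum, and bumps are 1-Lipschitz. *)
Lemma running_step n x y e : K x -> K y -> 0 <= e ->
  (forall z, K z -> 0 <= w x z -> 0 <= w z y -> `|x - z| <= e) ->
  running n y <= running n x + e.
Proof.
move=> Kx Ky e0 H; apply: running_le => // z Kz zy.
have [zx|xz] := leP 0 (w z x).
  by rewrite (le_trans (running_ub n _ _ Kz zx))// lerDl.
have {}xz : 0 <= w x z by rewrite (qa_anti Kw) oppr_ge0 ltW.
rewrite (le_trans (bump_lip n x z))// lerD ?H//.
by apply: running_ub => //; rewrite w_refl.
Qed.

(** By [qa_add], every z below x has w z y >= w x y / 2, so [qa_cont] keeps z at distance at least d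
    from y. A bump that is positive at y and has radius less than d/2 therefore vanishes on
    everything below x. *)
Lemma running_sep x y : K x -> K y -> 0 < w x y ->
  exists n, running n x < running n y.
Proof.
move=> Kx Ky xy.
have [d d0 Hd] := qa_cont Kw y (w x y / 2) Ky ltac:(lra).
have [k kd] : exists k : nat, k.+1%:R^-1 < d / 2.
  have d20 : 0 < d / 2 by lra.
  have [k _ /(_ k (leqnn k))] := near_infty_natSinv_lt (PosNum d20).
  by exists k.
have k0 : 0 < k.+1%:R^-1 :> R by rewrite invr_gt0.
have [m mk] := q_dense _ _ Ky k0.
exists (pickle (m, k)); apply: (@le_lt_trans _ _ 0); last first.
  apply: (@lt_le_trans _ _ (bump (pickle (m, k)) y)).
    by rewrite /bump pickleK/= lt_max subr_gt0 mk orbT.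
  by apply: running_ub => //; rewrite w_refl.
apply: running_le => // z Kz zx.
rewrite /bump pickleK/= ge_max lexx/= subr_le0 leNgt; apply/negP => zm.
have : `|y - z| <= `|y - q m| + `|z - q m|.
  by rewrite (distrC z) ler_distD.
have zy := qa_add Kw _ _ _ Kz Kx Ky zx (ltW xy).
move=> yz; have /(Hd _ Kz) : `|y - z| < d.
  by move: (k.+1%:R^-1) mk zm kd yz => a; lra.
by rewrite (qa_anti Kw) normrN ltNge (le_trans _ (ler_norm _))//; lra.
Qed.

Definition height (x : V) : R := halves_sum (running ^~ x).

Lemma height_lt x y : K x -> K y -> 0 < w x y -> height x < height y.
Proof.
move=> Kx Ky xy; have [n Hn] := running_sep x y Kx Ky xy.
apply: halves_sum_lt Hn => [| |k]; [exact: running01|exact: running01|].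
exact: running_mono (ltW xy).
Qed.

Lemma height_inj x y : K x -> K y -> height x = height y -> x = y.
Proof.
move=> Kx Ky; have [xy|xy|xy] := ltgtP 0 (w x y).
- by move=> fxy; have := height_lt _ _ Kx Ky xy; rewrite fxy ltxx.
- have yx : 0 < w y x by rewrite (qa_anti Kw) oppr_gt0.
  by move=> fxy; have := height_lt _ _ Ky Kx yx; rewrite fxy ltxx.
- by move=> _; apply: (qa_eq Kw).
Qed.

Lemma height_gt x y : K x -> K y -> height x < height y -> 0 < w x y.
Proof.
move=> Kx Ky fxy; rewrite ltNge; apply/negP; rewrite le_eqVlt => /orP[/eqP|] xy.
  by move: fxy; rewrite (qa_eq Kw _ _ Kx Ky xy) ltxx.
have yx : 0 < w y x by rewrite (qa_anti Kw) oppr_gt0.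
by have := height_lt _ _ Ky Kx yx; rewrite ltNge ltW.
Qed.

Lemma height_step x y e : K x -> K y -> 0 <= e ->
  (forall z, K z -> 0 <= w x z -> 0 <= w z y -> `|x - z| <= e) ->
  height y <= height x + e.
Proof.
move=> Kx Ky e0 H; apply: halves_sum_leD => [| |n]; try exact: running01.
exact: running_step.
Qed.

(** Order intervals are small in norm: if z lies between x and y, [qa_add] bounds |w x z| by 2 |w x
    y|, and [qa_near] then puts z close to x. So [height_step] applies from the lower of the two
    points. *)
Lemma height_cont x e : K x -> 0 < e ->
  exists2 d, 0 < d & forall y, K y -> `|x - y| < d -> `|height x - height y| <= e.
Proof.
move=> Kx e0; have [s s0 Hs] := qa_near Kw x (e / 2) Kx ltac:(lra).
have [d d0 Hd] := qa_cont Kw x (s / 2) Kx ltac:(lra).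
exists d => // y Ky /(Hd _ Ky) wxy.
have xye : `|x - y| < e / 2 by apply: Hs => //; lra.
have [xy|/ltW yx] := leP 0 (w x y).
- have mono : height x <= height y.
    have [/eqP|xy0] := eqVneq (w x y) 0.
      by move=> /eqP /(qa_eq Kw _ _ Kx Ky) ->.
    by rewrite ltW// height_lt// lt_neqAle eq_sym xy0.
  have : height y <= height x + e.
    apply: height_step => // [|z Kz xz zy]; first exact: ltW.
    apply: (@le_trans _ _ (e / 2)); last by lra.
    apply/ltW/Hs => //.
    have := qa_add Kw _ _ _ Kx Kz Ky xz zy; move: wxy.
    by rewrite !ger0_norm//; lra.
  by rewrite distrC ger0_norm ?subr_ge0//; lra.
- have {}yx : 0 <= w y x by rewrite (qa_anti Kw) oppr_ge0.
  have mono : height y <= height x.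
    have [/eqP|xy0] := eqVneq (w y x) 0.
      by move=> /eqP /(qa_eq Kw _ _ Ky Kx) ->.
    by rewrite ltW// height_lt// lt_neqAle eq_sym xy0.
  have : height x <= height y + e.
    apply: height_step => // [|z Kz yz zx]; first exact: ltW.
    apply: (@le_trans _ _ (`|x - y| + `|x - z|)).
      by rewrite (distrC x y) ler_distD.
    suff : `|x - z| < e / 2 by lra.
    apply/Hs => //.
    have := qa_add Kw _ _ _ Ky Kz Kx yz zx; move: wxy.
    rewrite (qa_anti Kw y x) (qa_anti Kw z x) !normrN !ger0_norm//; lra.
  by rewrite ger0_norm ?subr_ge0//; lra.
Qed.

Lemma height_continuous : {within K, continuous height}.
Proof.
apply/subspace_continuousP => x Kx; apply/cvgrPdist_le => e e0.
have [d d0 Hd] := height_cont x e Kx e0.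
rewrite near_withinE; apply/nbhs_normP; exists d => //= y xy Ky.
exact: Hd.
Qed.

Hypothesis K_compact : compact K.
Hypothesis K_dense : forall x y, K x -> K y -> 0 < w x y ->
  exists z, [/\ K z, 0 < w x z & 0 < w z y].

(** Compactness gives a largest value of [height] below t and a smallest one above t. If neither
    were t, density of the order would give a point of K with height strictly between them. *)
Lemma height_onto x y t : K x -> K y -> height x <= t <= height y ->
  exists2 z, K z & height z = t.
Proof.
move=> Kx Ky /andP[xt ty].
have cimg : compact (height @` K).
  exact: continuous_compact height_continuous K_compact.
have idc (A : set R) : {within A, continuous (@id R)}.
  by apply: continuous_subspaceT => u; exact: cvg_id.
have [|||a /set_mem[[a' Ka <-] at_] amax] := @compact_EVT_max _ R id
    (height @` K `&` [set u | u <= t]).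
- by exists (height x); split => //; exists x.
- exact: compact_closedI cimg (@closed_le _ t).
- exact: idc.
have [|||b /set_mem[[b' Kb <-] tb] bmin] := @compact_EVT_min _ R id
    (height @` K `&` [set u | t <= u]).
- by exists (height y); split => //; exists y.
- exact: compact_closedI cimg (@closed_ge _ t).
- exact: idc.
rewrite /= in at_ tb.
have [<-|nat_] := eqVneq (height a') t; first by exists a'.
have [<-|nbt] := eqVneq (height b') t; first by exists b'.
have lta : height a' < t by rewrite lt_neqAle nat_.
have ltb : t < height b' by rewrite lt_neqAle eq_sym nbt.
have [z [Kz az zb]] := K_dense _ _ Ka Kb (height_gt _ _ Ka Kb (lt_trans lta ltb)).
have [zt|tz] := leP (height z) t.
  have : height z <= height a'.
    by apply: amax; apply/mem_set; split => //; exists z.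
  by rewrite leNgt height_lt.
have : height b' <= height z.
  by apply: bmin; apply/mem_set; split; [exists z|exact: ltW].
by rewrite leNgt height_lt.
Qed.

(** The curve is the inverse of [height], with its range rescaled to [0, 1]; the two distinct points
    make that range nondegenerate. *)
Lemma quasi_additive_arc p p' : K p -> K p' -> p != p' ->
  exists gamma : R -> V, [/\ {within `[0, 1], continuous gamma},
    {in `[0, 1] &, injective gamma} & K = gamma @` `[0, 1]].
Proof.
move=> Kp Kp' pp'.
have K0 : K !=set0 by exists p.
have [M /set_mem KM HM] := compact_EVT_max K0 K_compact height_continuous.
have [m /set_mem Km Hm] := compact_EVT_min K0 K_compact height_continuous.
have mM : height m < height M.
  rewrite ltNge; apply/negP => Mm; move/eqP: pp'; apply.
  apply: height_inj => //.
  have := HM p (mem_set Kp); have := HM p' (mem_set Kp').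
  by have := Hm p (mem_set Kp); have := Hm p' (mem_set Kp'); lra.
pose h t := height m + t * (height M - height m).
have h_in t : `[0, 1]%classic t -> height m <= h t <= height M.
  rewrite /= in_itv/= => /andP[t0 t1]; rewrite /h lerDl mulr_ge0 ?subr_ge0 ?(ltW mM)//=.
  by have : (1 - t) * (height M - height m) >= 0;
    [rewrite mulr_ge0// ?subr_ge0 ?(ltW mM)//|lra].
have /choice[gamma Hg] : forall t, exists z,
    `[0, 1]%classic t -> K z /\ height z = h t.
  move=> t; have [/h_in ht|nt] := pselect (`[0, 1]%classic t); last by exists p.
  by have [z Kz hz] := height_onto _ _ _ Km KM ht; exists z.
have h_inj s t : h s = h t -> s = t.
  rewrite /h => /addrI/mulIf; apply.
  by rewrite subr_eq0 gt_eqF.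
exists gamma; split.
- apply/subspace_continuousP => t t01; apply/cvgrPdist_lt => e e0.
  have [Kt ht] := Hg _ t01.
  rewrite near_withinE.
  (* Continuity of the inverse: the points of K at distance at least e from gamma t have a compact,
     hence closed, set of heights. By injectivity it misses h t, hence also h s for s near t. *)
  pose K' := K `&` [set z | e <= `|gamma t - z|].
  have cK' : compact K'.
    apply: compact_closedI => //.
    have -> : [set z | e <= `|gamma t - z|] =
        (fun z : V => `|gamma t - z|) @^-1` [set u | e <= u] by [].
    apply: closed_comp => [z _|]; last exact: closed_ge.
    by apply: cvg_norm; apply: cvgB; [exact: cvg_cst|exact: cvg_id].
  have /(compact_closed (@Rhausdorff R)) clK' : compact (height @` K').
    apply: continuous_compact cK'.
    by apply: continuous_subspaceW height_continuous => z [].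
  have nK' : (~` (height @` K')) (h t).
    move=> [z [Kz /= ez] hz]; move: ez.
    by rewrite (height_inj z (gamma t)) ?subrr ?normr0 ?leNgt ?e0// ht.
  have hc : h @ t --> h t.
    apply: cvgD; first exact: cvg_cst.
    by apply: cvgM; [exact: cvg_id|exact: cvg_cst].
  have : \forall s \near t, (~` (height @` K')) (h s).
    by apply: hc; apply: open_nbhs_nbhs; split=> //; exact: closed_openC.
  apply: filterS => s ns s01.
  have [Ks hs] := Hg _ s01.
  rewrite ltNge; apply/negP => es; apply: ns.
  by exists (gamma s).
- move=> s t s01 t01 gst; apply: h_inj.
  by have [_ <-] := Hg _ s01; have [_ <-] := Hg _ t01; rewrite gst.
- apply/seteqP; split => [z Kz|_ [t t01 <-]]; last by case: (Hg _ t01).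
  pose t := (height z - height m) / (height M - height m).
  have htz : h t = height z.
    by rewrite /h /t divfK ?subr_eq0 ?gt_eqF//; lra.
  have t01 : `[0, 1]%classic t.
    rewrite /= in_itv/= /t divr_ge0 ?subr_ge0 ?(ltW mM) ?Hm//=; last exact: mem_set.
    rewrite ler_pdivrMr ?subr_gt0// mul1r lerD2r.
    by apply: HM; apply: mem_set.
  exists t => //; have [Kt ht] := Hg _ t01.
  by apply: height_inj => //; rewrite ht.
Qed.

End Arc.

(** * The gap and the rise on the Heisenberg group *)

Definition rat_point {R : realType} (n : nat) : R * R * R :=
  let p := odflt (0, 0, 0) (unpickle n : option (rat * rat * rat)) in
  (ratr p.1.1, ratr p.1.2, ratr p.2).

Lemma norm3_lt {R : realType} (x y : R * R * R) (e : R) :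
  (`|x - y| < e) =
  [&& `|x.1.1 - y.1.1| < e, `|x.1.2 - y.1.2| < e & `|x.2 - y.2| < e].
Proof. by rewrite !prod_normE /= !gt_max andbA. Qed.

Lemma rat_point_dense {R : realType} (x : R * R * R) (e : R) :
  0 < e -> exists n, `|x - rat_point n| < e.
Proof.
move=> e0.
have near_rat (u : R) : exists p : rat, `|u - ratr p| < e.
  have [|p] := @rat_in_itvoo _ (u - e) (u + e); first by lra.
  by rewrite in_itv/= => /andP[? ?]; exists p; rewrite ltr_norml; lra.
have [a Ha] := near_rat x.1.1; have [b Hb] := near_rat x.1.2.
have [c Hc] := near_rat x.2.
by exists (pickle (a, b, c)); rewrite norm3_lt /rat_point pickleK/= Ha Hb Hc.
Qed.

Section Gauge.
Context {R : realType}.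
Implicit Types A B C : heis R.

Definition hgap A B : R := (B.1.1 - A.1.1) ^+ 2 + (B.1.2 - A.1.2) ^+ 2.

Definition hrise A B : R :=
  B.2 - A.2 + 2 * (A.1.1 * B.1.2 - B.1.1 * A.1.2).

Lemma hrise_refl A : hrise A A = 0.
Proof. by rewrite /hrise; ring. Qed.

(** For s >= 0 this is d(A, B) <= sqrt s (see [hdist_le]). With squared scales the later estimates
    become linear in gaps and rises. *)
Definition hclose (s : R) A B : Prop := hgap A B <= s /\ `|hrise A B| <= s.

Lemma hgap_ge0 A B : 0 <= hgap A B.
Proof. by rewrite addr_ge0// sqr_ge0. Qed.

Lemma hgapC A B : hgap B A = hgap A B.
Proof. by rewrite /hgap; ring. Qed.

Lemma hrise_anti A B : hrise B A = - hrise A B.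
Proof. by rewrite /hrise; ring. Qed.

Lemma hcloseC s A B : hclose s A B -> hclose s B A.
Proof. by rewrite /hclose hgapC hrise_anti normrN. Qed.

Lemma hclose_le s t A B : s <= t -> hclose s A B -> hclose t A B.
Proof. by move=> st [? ?]; split; lra. Qed.

Lemma hgap_add A B C : hgap A C <= 2 * hgap A B + 2 * hgap B C.
Proof.
have := sqr_ge0 (2 * B.1.1 - A.1.1 - C.1.1).
by have := sqr_ge0 (2 * B.1.2 - A.1.2 - C.1.2); rewrite /hgap; lra.
Qed.

(** Up to sign, the defect is twice the determinant of the horizontal displacements from A to B and
    from B to C, which is bounded by the sum of their squared lengths. *)
Lemma hrise_add A B C :
  `|hrise A C - (hrise A B + hrise B C)| <= hgap A B + hgap B C.
Proof.
have sqD (u v : R) : - (u ^+ 2 + v ^+ 2) <= 2 * u * v <= u ^+ 2 + v ^+ 2.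
  by have := sqr_ge0 (u + v); have := sqr_ge0 (u - v); lra.
have := sqD (B.1.1 - A.1.1) (C.1.2 - B.1.2).
have := sqD (B.1.2 - A.1.2) (C.1.1 - B.1.1).
rewrite ler_norml /hrise /hgap; lra.
Qed.

Lemma hclose_trans s t A B C :
  hclose s A B -> hclose t B C -> hclose (2 * (s + t)) A C.
Proof.
move=> [AB wAB] [BC wBC]; have := hgap_add A B C; have := hrise_add A B C.
move: wAB wBC; rewrite /hclose !ler_norml; have := hgap_ge0 A B.
by have := hgap_ge0 B C; lra.
Qed.

Lemma hdist_ge0 A B : 0 <= hdist A B.
Proof. by rewrite /hdist /hnorm le_max sqrtr_ge0. Qed.

Lemma hdist_sqr A B : hdist A B ^+ 2 = Num.max (hgap A B) `|hrise A B|.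
Proof.
rewrite /hdist /hnorm /hmul /hinv/=.
set a := _ + _ ^+ 2; set b := `|_|.
have -> : a = hgap A B by rewrite /a /hgap; ring.
have -> : b = `|hrise A B|.
  by rewrite /b -normrN; congr `|_|; rewrite /hrise; ring.
have [ab|/ltW ba] := leP (hgap A B) `|hrise A B|.
  by rewrite max_r ?ler_wsqrtr// sqr_sqrtr.
by rewrite max_l ?ler_wsqrtr// sqr_sqrtr// hgap_ge0.
Qed.

Lemma hdist_le r A B : 0 <= r -> hdist A B <= r <-> hclose (r ^+ 2) A B.
Proof.
move=> r0; rewrite -(@ler_pXn2r _ 2) ?nnegrE ?hdist_ge0// hdist_sqr ge_max.
by split=> /andP.
Qed.

Lemma hdist_lt r A B : 0 <= r ->
  hdist A B < r <-> hgap A B < r ^+ 2 /\ `|hrise A B| < r ^+ 2.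
Proof.
move=> r0; rewrite -(@ltr_pXn2r _ 2) ?nnegrE ?hdist_ge0// hdist_sqr gt_max.
by split=> /andP.
Qed.

Lemma continuous_fst3 : continuous (fun B : R * R * R => B.1.1).
Proof. by move=> B; apply: continuous_comp; exact: cvg_fst. Qed.

Lemma continuous_snd3 : continuous (fun B : R * R * R => B.1.2).
Proof. by move=> B; apply: continuous_comp; [exact: cvg_fst|exact: cvg_snd]. Qed.

Lemma continuous_hgap A : continuous (fun B : R * R * R => hgap A B).
Proof.
have c1 : continuous (fun B : R * R * R => B.1.1 - A.1.1).
  by move=> B; apply: cvgB; [exact: continuous_fst3|exact: cvg_cst].
have c2 : continuous (fun B : R * R * R => B.1.2 - A.1.2).
  by move=> B; apply: cvgB; [exact: continuous_snd3|exact: cvg_cst].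
by move=> B; apply: cvgD; [exact: (cvgM (c1 B) (c1 B))|exact: (cvgM (c2 B) (c2 B))].
Qed.

Lemma continuous_hrise A : continuous (fun B : R * R * R => hrise A B).
Proof.
move=> B; apply: cvgD.
  by apply: cvgB; [exact: cvg_snd|exact: cvg_cst].
apply: cvgM; first exact: cvg_cst.
apply: cvgB; apply: cvgM; try exact: cvg_cst.
  exact: continuous_snd3.
exact: continuous_fst3.
Qed.

Lemma hclose_nbhs (A : R * R * R) (s : R) : 0 < s -> nbhs A (hclose s A).
Proof.
move=> s0; have gA : hgap A A = 0 by rewrite /hgap; ring.
have wA := hrise_refl A.
have N1 : \forall B \near A, `|hgap A A - hgap A B| < s.
  by move: (continuous_hgap A A) => /cvgrPdist_lt; apply.
have N2 : \forall B \near A, `|hrise A A - hrise A B| < s.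
  by move: (continuous_hrise A A) => /cvgrPdist_lt; apply.
apply: filterS2 N1 N2 => B; rewrite gA wA !sub0r !normrN => H1 H2; split.
  by rewrite (le_trans (ler_norm _))// ltW.
exact: ltW.
Qed.

Lemma nbhs_hclose (A : R * R * R) (e : R) : 0 < e ->
  exists2 s : R, 0 < s & forall B, hclose s A B -> `|A - B| < e.
Proof.
(* The difference of the third coordinates is the rise corrected by 2 (A.x dy - A.y dx), up to sign.
   When gap and |rise| are at most t^2 <= t, it is at most t M. *)
move=> e0; pose M := 1 + 2 * `|A.1.1| + 2 * `|A.1.2|.
have M1 : 1 <= M by rewrite /M -addrA lerDl addr_ge0// mulr_ge0.
pose t := Num.min 1 (e / (2 * M)).
have t0 : 0 < t by rewrite lt_min ltr01 divr_gt0//; lra.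
have t1 : t <= 1 by rewrite ge_min lexx.
have tM : t * M < e.
  apply: (@le_lt_trans _ _ (e / (2 * M) * M)).
    by rewrite ler_pM2r ?ge_min ?lexx ?orbT//; lra.
  have -> : e / (2 * M) * M = e / 2 by field; rewrite gt_eqF//; lra.
  lra.
exists (t ^+ 2) => [|B [gap]]; first by rewrite exprn_gt0.
have sq_le (u : R) : u ^+ 2 <= t ^+ 2 -> `|u| <= t.
  by rewrite -real_normK ?num_real// ler_pXn2r ?nnegrE// ltW.
have dx : `|B.1.1 - A.1.1| <= t.
  by apply: sq_le; move: gap; rewrite /hgap; have := sqr_ge0 (B.1.2 - A.1.2); lra.
have dy : `|B.1.2 - A.1.2| <= t.
  by apply: sq_le; move: gap; rewrite /hgap; have := sqr_ge0 (B.1.1 - A.1.1); lra.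
move=> wt.
have zE : A.2 - B.2 = - hrise A B + 2 * (A.1.1 * (B.1.2 - A.1.2))
    - 2 * (A.1.2 * (B.1.1 - A.1.1)) by rewrite /hrise; ring.
have dz : `|A.2 - B.2| <= t * M.
  have p1 : `|A.1.1 * (B.1.2 - A.1.2)| <= `|A.1.1| * t.
    by rewrite normrM ler_wpM2l.
  have p2 : `|A.1.2 * (B.1.1 - A.1.1)| <= `|A.1.2| * t.
    by rewrite normrM ler_wpM2l.
  have tt : t ^+ 2 <= t by rewrite expr2 ler_piMl// ltW.
  rewrite zE /M; move: p1 p2 wt; rewrite !ler_norml; lra.
have tle : t <= t * M by rewrite ler_peMr// ltW.
rewrite norm3_lt distrC (distrC A.1.2).
by apply/and3P; split; lra.
Qed.

End Gauge.

Arguments hcloseC {R s A B}.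
Arguments hclose_trans {R s t A B C}.

(** * Reifenberg flat sets *)

Section Flatness.
Context {R : realType}.
Implicit Types (A B C : heis R) (S T E U : set (heis R)).

(** The infima in the distance need not be attained, hence the strict inequality c < d. For the same
    reason the flatness lemmas work with some e > eps. *)
Lemma hausdorff_dist_approx S T (c d : R) :
  (hausdorff_dist S T <= c%:E)%E -> c < d ->
  (forall B, S B -> exists2 C, T C & hdist B C < d) /\
  (forall B, T B -> exists2 C, S C & hdist B C < d).
Proof.
rewrite /hausdorff_dist ge_max => /andP[ST TS] cd.
have approx (X Y : set (heis R)) B :
    (ereal_sup [set hdist_set A Y | A in X] <= c%:E)%E -> X B ->
    exists2 C, Y C & hdist B C < d.
  move=> XY XB; have : (hdist_set B Y < d%:E)%E.
    apply: (@le_lt_trans _ _ c%:E); last by rewrite lte_fin.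
    by apply: le_trans XY; apply: ereal_sup_ubound; exists B.
  by move=> /ereal_inf_lt[_ [C YC <-]]; rewrite lte_fin; exists C.
by split=> B; exact: approx.
Qed.

Variables (E U : set (heis R)) (eps e r0 : R).
Hypotheses (eps_lt_e : eps < e) (e_lt1 : e < 1) (e_gt0 : 0 < e) (r0_gt0 : 0 < r0).
Hypothesis flat : reifenberg_flat_vertical E eps U r0.

(** At scale d(A, B), some point of the vertical line through A is within e d(A, B) of B, so the gap
    is at most e^2 max(gap, |rise|). Since e < 1, the maximum cannot be a positive gap. The case
    d(A, B) = 0 is separate, as flatness requires a positive scale. *)
Lemma flat_gap A B : E A -> U A -> E B -> hclose (r0 ^+ 2) A B ->
  hgap A B <= e ^+ 2 * `|hrise A B|.
Proof.
move=> EA UA EB /hdist_le -/(_ (ltW r0_gt0)) Br0.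
have := hdist_ge0 A B; rewrite le_eqVlt => /orP[/eqP d0|d_gt0].
  have := hdist_sqr A B; rewrite -d0 expr0n/= => /esym /eqP; rewrite eq_le ge_max.
  move=> /andP[/andP[gap0 _] _]; rewrite (le_trans gap0)//.
  by rewrite mulr_ge0// sqr_ge0.
have [_ /(_ _ _ EA UA d_gt0 Br0) H] := flat.
have lt_rad : hdist A B * eps < hdist A B * e by rewrite ltr_pM2l.
have [/(_ B)[]] := hausdorff_dist_approx _ _ _ _ H lt_rad.
  by split => //; rewrite /hcball/=.
move=> C [CA _] dBC _.
have /hdist_lt[|gBC _] := dBC; first by rewrite mulr_ge0// ltW.
have {gBC} : hgap A B < (hdist A B * e) ^+ 2.
  by rewrite -hgapC (le_lt_trans _ gBC)// /hgap (CA : C.1 = A.1).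
rewrite exprMn hdist_sqr /Num.max; case: ifP => _ gap.
  by rewrite mulrC ltW.
have e2 : e ^+ 2 < 1 by rewrite expr_lt1// ltW.
have := hgap_ge0 A B; nra.
Qed.

Lemma flat_point A (s h : R) : E A -> U A -> 0 < s -> s <= r0 ^+ 2 -> `|h| <= s ->
  exists B, [/\ E B, hclose s A B, hgap A B <= e ^+ 2 * s
    & `|hrise A B - h| <= e ^+ 2 * s].
Proof.
move=> EA UA s0 sr0 hs; pose r := Num.sqrt s.
have r_gt0 : 0 < r by rewrite sqrtr_gt0.
have rs : r ^+ 2 = s by rewrite sqr_sqrtr// ltW.
have rr0 : r <= r0.
  by rewrite -(@ler_pXn2r _ 2) ?nnegrE ?(ltW r_gt0) ?(ltW r0_gt0)// rs.
have [_ /(_ _ _ EA UA r_gt0 rr0) H] := flat.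
have lt_rad : r * eps < r * e by rewrite ltr_pM2l.
(* The target on the vertical line: A translated by h along the centre. *)
pose C0 : heis R := (A.1, A.2 + h).
have gC0 B : hgap C0 B = hgap A B by [].
have rC0 B : hrise C0 B = hrise A B - h by rewrite /hrise/=; ring.
have [_ /(_ C0)[]] := hausdorff_dist_approx _ _ _ _ H lt_rad.
  split => //; rewrite /hcball/=; apply/hdist_le; first exact: ltW.
  rewrite rs /hclose hgapC hrise_anti gC0 rC0 /hgap /hrise; split.
    by rewrite !subrr expr0n addr0 ltW.
  by rewrite (_ : - _ = h)//; ring.
move=> B [EB /= ABr] dB; exists B.
have /hdist_le[|g1 w1] := ltW dB; first by rewrite mulr_ge0// ltW.
move: g1 w1; rewrite gC0 rC0 exprMn rs mulrC => g1 w1; split=> //.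
by move/hdist_le: ABr; rewrite rs; apply; exact: ltW.
Qed.

End Flatness.

(** * The arc around a point of a nearly vertical set *)

Section LocalArc.
Context {R : realType}.
Variables (E U : set (heis R)) (s : R) (A : heis R).
Hypothesis s_gt0 : 0 < s.
Hypothesis E_compact : compact E.
Hypothesis gap_le : forall x y, E x -> U x -> E y -> hclose (100 * s) x y ->
  hgap x y <= 100^-1 * `|hrise x y|.
Hypothesis point_near : forall x (t h : R), E x -> U x -> 0 < t -> t <= 100 * s ->
  `|h| <= t -> exists y, [/\ E y, hclose t x y, hgap x y <= 100^-1 * t
    & `|hrise x y - h| <= 100^-1 * t].
Hypothesis U_near : forall x, hclose (100 * s) A x -> U x.
Hypothesis EA : E A.

(** A region large enough to contain inserted points before they are known to lie in V. Any two of
    its points are [hclose (40 * s)], within the range of [gap_le]. *)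
Let D x := E x /\ hclose (10 * s) A x.

Let hcloseAA t : 0 <= t -> hclose t A A.
Proof.
move=> t0; rewrite /hclose /hgap /hrise !subrr expr0n/= addr0.
by rewrite (_ : 0 + _ = 0) ?normr0//; ring.
Qed.

Let DU x : D x -> U x.
Proof.
have s0 := s_gt0; move=> [_ Ax]; apply: U_near; apply: hclose_le Ax; lra.
Qed.

Let D_gap x y : D x -> D y -> hgap x y <= 100^-1 * `|hrise x y|.
Proof.
have s0 := s_gt0; move=> Dx Dy; apply: gap_le; [by case: Dx|exact: DU|by case: Dy|].
apply: hclose_le (hclose_trans (hcloseC Dx.2) Dy.2).
by lra.
Qed.

(** The defect in [hrise_add] is at most the sum of the two gaps, that is 1/100 of the sum of the
    two rises. *)
Let D_add x y z : D x -> D y -> D z -> 0 <= hrise x y -> 0 <= hrise y z ->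
  (99 / 100) * (hrise x y + hrise y z) <= hrise x z.
Proof.
move=> Dx Dy Dz xy yz; have := D_gap _ _ Dx Dy; have := D_gap _ _ Dy Dz.
have := hrise_add x y z; rewrite (ger0_norm xy) (ger0_norm yz) ler_norml.
by lra.
Qed.

Lemma local_arc : exists V : set (heis R), nbhs A V /\
  exists gamma : R -> heis R, simple_curve gamma /\ E `&` V = gamma @` `[0, 1].
Proof.
have s0 := s_gt0.
have DA : D A by split => //; apply: hcloseAA; lra.
have UA := DU _ DA.
have s40 : 0 < s / 4 by lra.
have s4s0 : s / 4 <= 100 * s by lra.
have hs (h : R) : `|h| = s / 8 -> `|h| <= s / 4 by move=> ->; lra.
(* At squared scale s/4 the error s/400 is far below the target rises s/8 and -s/8, so P < A < Q
   strictly. *)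
have [Q [EQ AQ gQ wQ]] : exists y, [/\ E y, hclose (s / 4) A y,
    hgap A y <= 100^-1 * (s / 4) & `|hrise A y - s / 8| <= 100^-1 * (s / 4)].
  by apply: point_near => //; apply: hs; rewrite ger0_norm//; lra.
have [P [EP AP gP wP]] : exists y, [/\ E y, hclose (s / 4) A y,
    hgap A y <= 100^-1 * (s / 4) & `|hrise A y - - (s / 8)| <= 100^-1 * (s / 4)].
  by apply: point_near => //; apply: hs; rewrite normrN ger0_norm//; lra.
have DP : D P by split => //; apply: hclose_le AP; lra.
have DQ : D Q by split => //; apply: hclose_le AQ; lra.
have {}wQ : 0 < hrise A Q <= s / 4 by move: wQ; rewrite ler_norml; lra.
have {}wP : 0 < hrise P A <= s / 4.
  by move: wP; rewrite (hrise_anti A P) ler_norml; lra.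
have wPQ : 0 < hrise P Q.
  by have := D_add _ _ _ DP DA DQ; lra.
pose V : set (heis R) :=
  [set x | [/\ hclose s A x, 0 <= hrise P x & 0 <= hrise x Q]].
have KD x : (E `&` V) x -> D x.
  by move=> [Ex [Ax _ _]]; split => //; apply: hclose_le Ax; lra.
have Kgap x y : (E `&` V) x -> (E `&` V) y -> hgap x y <= 100^-1 * `|hrise x y|.
  by move=> /KD Dx /KD Dy; exact: D_gap.
have hriseE (x y : heis R) : hrise x y = - hrise y x by rewrite hrise_anti.
exists V; split.
  have nP : \forall x \near (A : R * R * R), `|hrise P A - hrise P x| < hrise P A.
    by move: (continuous_hrise P A) => /cvgrPdist_lt; apply; case/andP: wP.
  have nQ : \forall x \near (A : R * R * R), `|hrise Q A - hrise Q x| < hrise A Q.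
    by move: (continuous_hrise Q A) => /cvgrPdist_lt; apply; case/andP: wQ.
  have nA := hclose_nbhs A s s_gt0.
  apply: filterS3 nA nP nQ => x Ax xP xQ; split => //.
    by move: xP; rewrite ltr_norml; lra.
  by move: xQ; rewrite (hriseE Q A) (hriseE Q x) ltr_norml; lra.
have Vclosed : closed (V : set (R * R * R)).
  have -> : V = ((fun x : R * R * R => hgap A x) @^-1` [set u | u <= s]) `&`
      (((fun x : R * R * R => hrise A x) @^-1` [set u | u <= s]) `&`
      (((fun x : R * R * R => hrise A x) @^-1` [set u | - s <= u]) `&`
      (((fun x : R * R * R => hrise P x) @^-1` [set u | 0 <= u]) `&`
      ((fun x : R * R * R => hrise Q x) @^-1` [set u | u <= 0])))).
    apply/seteqP; split => x; rewrite /V /hclose/= (hriseE x Q) ler_norml.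
      by move=> [[? /andP[? ?]] ? ?]; do !split => //; lra.
    by move=> [? [? [? [? ?]]]]; split; [split => //; apply/andP| |]; lra.
  by do !apply: closedI; apply: closed_comp => [x _|];
    do ?[exact: continuous_hgap|exact: continuous_hrise
        |exact: closed_le|exact: closed_ge].
have K_compact : compact (E `&` V : set (R * R * R)) by exact: compact_closedI.
have K_quasi : quasi_additive (E `&` V : set (R * R * R)) hrise.
  split.
  - by move=> x y; exact: hrise_anti.
  - move=> x y Kx Ky xy; have := Kgap _ _ Kx Ky; rewrite xy normr0 mulr0.
    move=> gap0; have : hgap x y == 0 by rewrite eq_le gap0 hgap_ge0.
    rewrite /hgap paddr_eq0 ?sqr_ge0// !sqrf_eq0 !subr_eq0 => /andP[/eqP e1 /eqP e2].
    have e3 : x.2 = y.2 by move: xy; rewrite /hrise e1 e2; lra.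
    by case: x y e1 e2 e3 {Kx Ky xy gap0} => [[? ?] ?] [[? ?] ?]/= -> -> ->.
  - move=> x y z /KD Dx /KD Dy /KD Dz xy yz.
    by have := D_add _ _ _ Dx Dy Dz xy yz; lra.
  - move=> x e Kx e0; have [t t0 Ht] := nbhs_hclose x e e0.
    exists t => // y Ky wt; apply: Ht; split; last exact: ltW.
    apply: le_trans (Kgap _ _ Kx Ky) _.
    by have := normr_ge0 (hrise x y); lra.
  - move=> x t Kx t0; have : \forall y \near x, `|hrise x x - hrise x y| < t.
      by move: (continuous_hrise x x) => /cvgrPdist_lt; apply.
    move=> /nbhs_normP[d /= d0 Hd]; exists d => // y _ xy.
    by have := Hd y xy; rewrite /= hrise_refl sub0r normrN.
have K_dense x y : (E `&` V) x -> (E `&` V) y -> 0 < hrise x y ->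
    exists z, [/\ (E `&` V) z, 0 < hrise x z & 0 < hrise z y].
  move=> Kx Ky xy; have Dx := KD _ Kx; have Dy := KD _ Ky.
  have [[Ex [Ax Px xQ]] [Ey [Ay Py yQ]]] := (Kx, Ky).
  have u4 : hrise x y <= 4 * s.
    have [_] := hclose_trans (hcloseC Ax) Ay.
    by rewrite (ger0_norm (ltW xy)); lra.
  have [z [Ez xz gxz wxz]] : exists z, [/\ E z, hclose (hrise x y) x z,
      hgap x z <= 100^-1 * hrise x y & `|hrise x z - hrise x y / 2| <= 100^-1 * hrise x y].
    apply: point_near => //; [exact: DU|lra|].
    by rewrite ger0_norm; lra.
  (* Since x is within squared scale s of A and z within 4 s of x, z is within 2 (s + 4 s) = 10 s of
     A; this fixes the size of [D]. *)
  have Dz : D z.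
    by split => //; apply: hclose_le (hclose_trans Ax xz); lra.
  have {}wxz : 49 / 100 * hrise x y <= hrise x z <= 51 / 100 * hrise x y.
    by move: wxz; rewrite ler_norml; lra.
  (* Going through x, gap(z, y) is at most 4/100 of rise(x, y). The defect is then at most 5/100 of
     it, less than the 49/100 left for rise(z, y). *)
  have gxy := D_gap _ _ Dx Dy; rewrite (ger0_norm (ltW xy)) in gxy.
  have gzy := hgap_add z x y; rewrite (hgapC x z) in gzy.
  have wzy : 0 < hrise z y.
    have := hrise_add x z y; rewrite ler_norml; lra.
  have wxz0 : 0 < hrise x z by lra.
  exists z; split => //; split => //.
  have Pz : 0 <= hrise P z.
    have := D_add _ _ _ DP Dx Dz Px (ltW wxz0); lra.
  have zQ : 0 <= hrise z Q.
    have := D_add _ _ _ Dz Dy DQ (ltW wzy) yQ; lra.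
  split => //.
  (* Being between P and Q forces z into the ball: on either side of A, its rise from A is at most
     100/99 of s/4 in absolute value, and its gap is smaller still. *)
  have [Az|/ltW zA] := leP 0 (hrise A z).
    have := D_add _ _ _ DA Dz DQ Az zQ; have := D_gap _ _ DA Dz.
    by rewrite /hclose (ger0_norm Az); lra.
  have {}zA : 0 <= hrise z A by rewrite (hriseE z) oppr_ge0.
  have := D_add _ _ _ DP Dz DA Pz zA; have := D_gap _ _ Dz DA.
  rewrite /hclose (hgapC z A) (hriseE A z) normrN (ger0_norm zA).
  by lra.
have KP : (E `&` V) P.
  by split => //; split => //; [apply: hclose_le AP; lra|by rewrite hrise_refl|exact: ltW].
have KQ : (E `&` V) Q.
  by split => //; split => //; [apply: hclose_le AQ; lra|exact: ltW|by rewrite hrise_refl].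
have PQ : P != Q :> R * R * R.
  by apply/eqP => PQ; move: wPQ; rewrite PQ hrise_refl ltxx.
have [gamma [gc gi gK]] := quasi_additive_arc _ _ _ K_quasi
  (fun x e _ => rat_point_dense x e) K_compact K_dense P Q KP KQ PQ.
by exists gamma.
Qed.

End LocalArc.

Theorem mainTheorem2 (R : realType) :
  exists eps0 : R, 0 < eps0 /\
    forall eps rad : R, 0 <= eps -> eps <= eps0 -> 0 < rad ->
    forall E : set (heis R),
      compact E ->
      (exists r0 : R, 0 < r0 /\
        reifenberg_flat_vertical E eps (hcball horigin rad) r0) ->
      forall A : heis R, (E `&` hball horigin rad) A ->
        exists V : set (heis R), nbhs A V /\
          exists gamma : R -> heis R,
            simple_curve gamma /\ E `&` V = gamma @` `[0, 1].
Proof.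
(* Any value below 1/10 leaves room for the strict inequality eps < e with e = 1/10, and e^2 is the
   1/100 assumed by [local_arc]. *)
exists 20^-1; split => [|eps rad _ eps_le rad0 E cE [r0 [r00 flat]] A [EA Arad]].
  by rewrite invr_gt0.
have eps_lt : eps < 10^-1 by lra.
have e1 : 10^-1 < 1 :> R by lra.
have e0 : 0 < 10^-1 :> R by lra.
have eE : 10^-1 ^+ 2 = 100^-1 :> R by rewrite exprVn -natrX.
have [gA wA] : hgap horigin A < rad ^+ 2 /\ `|hrise horigin A| < rad ^+ 2.
  by apply/hdist_lt => //; exact: ltW.
have [d d0 Hd] : exists2 d : R, 0 < d & forall B : R * R * R, `|A - B| < d ->
    hgap horigin B < rad ^+ 2 /\ `|hrise horigin B| < rad ^+ 2.
  have N1 : \forall B \near (A : R * R * R),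
      `|hgap horigin A - hgap horigin B| < rad ^+ 2 - hgap horigin A.
    by move: (continuous_hgap horigin A) => /cvgrPdist_lt; apply; rewrite subr_gt0.
  have N2 : \forall B \near (A : R * R * R),
      `|hrise horigin A - hrise horigin B| < rad ^+ 2 - `|hrise horigin A|.
    by move: (continuous_hrise horigin A) => /cvgrPdist_lt; apply; rewrite subr_gt0.
  have : \forall B \near (A : R * R * R),
      hgap horigin B < rad ^+ 2 /\ `|hrise horigin B| < rad ^+ 2.
    apply: filterS2 N1 N2 => B H1 H2; split.
      by move: H1; rewrite ltr_norml; lra.
    have := lerB_dist (hrise horigin B) (hrise horigin A).
    by rewrite distrC; lra.
  by move=> /nbhs_normP[d /= d0 Hd]; exists d.
have [t t0 Ht] := nbhs_hclose A d d0.
(* The bound t keeps nearby points in the ball of radius [rad]; r0 is squared because [hclose]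
   measures squared scales. *)
pose s0 := Num.min t (r0 ^+ 2).
have s0t : s0 <= t by rewrite ge_min lexx.
have s0r : s0 <= r0 ^+ 2 by rewrite ge_min lexx orbT.
have s0E : 100 * (s0 / 100) = s0 by field.
apply: (@local_arc R E (hcball horigin rad) (s0 / 100) A); rewrite ?s0E => //.
- by rewrite divr_gt0// lt_min t0 exprn_gt0.
- move=> x y Ex Ux Ey xy; rewrite -eE.
  by apply: (flat_gap E (hcball horigin rad) eps _ r0) => //; apply: hclose_le xy.
- move=> x s h Ex Ux s_gt0 ss0 hs; rewrite -eE.
  by apply: (flat_point E (hcball horigin rad) eps _ r0) => //; exact: le_trans ss0 s0r.
- move=> x Ax; have [|g w] := Hd x; first by apply: Ht; exact: hclose_le Ax.
  by rewrite /hcball/=; apply/ltW/hdist_lt => //; exact: ltW.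
Qed.
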